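(* Let $U = U_{d,n}$ be a uniform matroid, with $1\le d \le n$, let $\mathcal{C}$ be its collection of circuits, and let $i$ be any fixed element of its ground set $[n]$. Then $$\mathcal{B} = \{C \in \mathcal{C} : i \in C\}$$ is an inclusion-minimal tropical basis of $U$ (i.e. $\mathcal{B}$ is a tropical basis and no proper subset of $\mathcal{B}$ is a tropical basis).
   Context: The uniform matroid $U_{d,n}$ on $[n]=\{1,\dots,n\}$ is the matroid whose circuits are exactly the $(d+1)$-element subsets of $[n]$. Let $\mathbb{T} = \mathbb{R} \cup \{\infty\}$ and let $\mathbb{TP}^{n-1} = (\mathbb{T}^n \setminus \{(\infty,\dots,\infty)\})/\mathbb{R}(1,\dots,1)$. For a circuit $C$ let $\mathcal{T}(C)$ be the set of points $x \in \mathbb{TP}^{n-1}$ such that the minimum of $\{x_j : j \in C\}$ is attained at least twice, i.e. by at least two distinct indices $j \in C$ (this includes the case where all $x_j$, $j\in C$, are $\infty$). For $\mathcal{B} \subset \mathcal{C}$ let $\mathcal{T}(\mathcal{B}) = \bigcap_{C \in \mathcal{B}} \mathcal{T}(C)$; $\mathcal{B}$ is a tropical basis if $\mathcal{T}(\mathcal{B}) = \mathcal{T}(\mathcal{C})$. *)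

(* Defs.v *)
From HB Require Import structures.
From mathcomp Require Import all_boot all_order all_algebra.
From mathcomp Require Import generic_quotient.
From mathcomp Require Import boolp classical_sets reals ereal.

Set Implicit Arguments.
Unset Strict Implicit.
Unset Printing Implicit Defensive.

Import Order.TTheory GRing.Theory Num.Theory.
Local Open Scope ring_scope.
Local Open Scope quotient_scope.

(* The ground set [n] = {1, ..., n} is represented by 'I_n = {0, ..., n-1}. *)

Record matroid (n : nat) := Matroid {
  circuits : {set {set 'I_n}};
  circuits_nonempty : finset.set0 \notin circuits;
  circuits_antichain : forall C1 C2 : {set 'I_n},
    C1 \in circuits -> C2 \in circuits -> C1 \subset C2 -> C1 = C2;
  circuits_elimination : forall (C1 C2 : {set 'I_n}) (e : 'I_n),
    C1 \in circuits -> C2 \in circuits -> C1 != C2 -> e \in C1 :&: C2 ->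
    exists2 C3 : {set 'I_n}, C3 \in circuits & C3 \subset (C1 :|: C2) :\ e
}.

Definition uniform_circuits (d n : nat) : {set {set 'I_n}} :=
  [set C : {set 'I_n} | #|C| == d.+1].

Lemma uniform_circuits_nonempty (d n : nat) :
  finset.set0 \notin uniform_circuits d n.
Proof. by rewrite inE cards0. Qed.

Lemma uniform_circuits_antichain (d n : nat) (C1 C2 : {set 'I_n}) :
  C1 \in uniform_circuits d n -> C2 \in uniform_circuits d n ->
  C1 \subset C2 -> C1 = C2.
Proof.
rewrite !inE => /eqP h1 /eqP h2 s12.
by apply/eqP; rewrite eqEcard s12 h1 h2 leqnn.
Qed.

Lemma uniform_circuits_elimination (d n : nat) (C1 C2 : {set 'I_n}) (e : 'I_n) :
  C1 \in uniform_circuits d n -> C2 \in uniform_circuits d n -> C1 != C2 ->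
  e \in C1 :&: C2 ->
  exists2 C3 : {set 'I_n},
    C3 \in uniform_circuits d n & C3 \subset (C1 :|: C2) :\ e.
Proof.
rewrite !inE => /eqP h1 /eqP h2 ne12 /andP[e1 e2].
have pU : (d.+1 < #|C1 :|: C2|)%N.
  rewrite -h1; apply: proper_card; rewrite properE finset.subsetUl /=.
  apply: contra ne12; rewrite finset.subUset => /andP[_ s21].
  by rewrite eq_sym eqEcard s21 h1 h2 leqnn.
have cU : (d.+1 <= #|(C1 :|: C2) :\ e|)%N.
  by move: pU; rewrite (cardsD1 e (C1 :|: C2)) inE e1 add1n ltnS.
have : (0 < #|[set A : {set 'I_n} | A \subset (C1 :|: C2) :\ e & #|A| == d.+1]|)%N.
  by rewrite cards_draws bin_gt0.
case/card_gt0P=> C3; rewrite inE => /andP[s3 h3].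
by exists C3; rewrite ?inE.
Qed.

Definition uniform_matroid (d n : nat) : matroid n :=
  Matroid (@uniform_circuits_nonempty d n) (@uniform_circuits_antichain d n)
    (@uniform_circuits_elimination d n).

(* T = R `|` {+oo}, with the order inherited from the extended reals. *)
Definition tropical (R : realType) := {x : \bar R | x != -oo%E}.

Definition tropical_vec (R : realType) (n : nat) :=
  {x : {ffun 'I_n -> tropical R} | [exists j, val (x j) != +oo%E]}.

Definition tropical_coord (R : realType) (n : nat) (x : tropical_vec R n)
    (j : 'I_n) : \bar R :=
  val (val x j).

Definition tropical_translate (R : realType) (n : nat) :
    rel (tropical_vec R n) :=
  fun x y => `[< exists c : R, forall j : 'I_n,
    tropical_coord y j = (c%:E + tropical_coord x j)%E >].

Lemma tropical_translate_refl (R : realType) (n : nat) :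
  reflexive (@tropical_translate R n).
Proof. by move=> x; apply/asboolP; exists 0 => j; rewrite add0e. Qed.

Lemma tropical_translate_sym (R : realType) (n : nat) :
  symmetric (@tropical_translate R n).
Proof.
suff h (x y : tropical_vec R n) : tropical_translate x y -> tropical_translate y x.
  by move=> x y; apply/idP/idP; apply: h.
move=> /asboolP[c hc]; apply/asboolP; exists (- c) => j.
by rewrite hc addeA -EFinD addNr add0e.
Qed.

Lemma tropical_translate_trans (R : realType) (n : nat) :
  transitive (@tropical_translate R n).
Proof.
move=> y x z /asboolP[c hc] /asboolP[c' hc']; apply/asboolP.
by exists (c' + c) => j; rewrite hc' hc addeA -EFinD.
Qed.

Definition tropical_translate_equiv (R : realType) (n : nat) :
    equiv_rel (tropical_vec R n) :=
  EquivRel (@tropical_translate R n) (@tropical_translate_refl R n)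
    (@tropical_translate_sym R n) (@tropical_translate_trans R n).

(* Tropical projective space TP^(n-1). *)
Definition tropical_proj (R : realType) (n : nat) :=
  {eq_quot (@tropical_translate_equiv R n)}.

Definition min_attained_twice (R : realType) (n : nat) (C : {set 'I_n})
    (x : tropical_vec R n) : bool :=
  (2 <= #|[set j in C | [forall k in C,
             (tropical_coord x j <= tropical_coord x k)%E]]|)%N.

(* The condition does not depend on the representative of the class p, see
   [tropical_hyp_pi]. *)
Definition tropical_hyp (R : realType) (n : nat) (C : {set 'I_n}) :
    set (tropical_proj R n) :=
  [set p | min_attained_twice C (repr p)]%classic.

Lemma min_attained_twice_translate (R : realType) (n : nat) (C : {set 'I_n})
    (x y : tropical_vec R n) :
  tropical_translate x y -> min_attained_twice C x = min_attained_twice C y.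
Proof.
move=> /asboolP[c hc]; rewrite /min_attained_twice; congr (_ <= _)%N.
apply: eq_card => j; rewrite !inE; congr (_ && _).
by apply: eq_forallb_in => k _; rewrite !hc leeD2lE.
Qed.

Lemma tropical_hyp_pi (R : realType) (n : nat) (C : {set 'I_n})
    (x : tropical_vec R n) :
  tropical_hyp C (\pi_(tropical_proj R n) x) <-> min_attained_twice C x.
Proof.
rewrite /tropical_hyp /=.
rewrite (@min_attained_twice_translate _ _ _ (repr (\pi_(tropical_proj R n) x)) x) //.
by apply/(@eqmodP _ (tropical_translate_equiv R n)); rewrite reprK.
Qed.

Definition tropical_prevariety (R : realType) (n : nat)
    (B : {set {set 'I_n}}) : set (tropical_proj R n) :=
  (\bigcap_(C in [set` B]) @tropical_hyp R n C)%classic.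
Arguments tropical_prevariety R {n} B _.

Definition tropical_basis (R : realType) (n : nat) (M : matroid n)
    (B : {set {set 'I_n}}) : Prop :=
  B \subset circuits M /\
  tropical_prevariety R B = tropical_prevariety R (circuits M).

Definition minimal_tropical_basis (R : realType) (n : nat) (M : matroid n)
    (B : {set {set 'I_n}}) : Prop :=
  tropical_basis R M B /\
  forall B' : {set {set 'I_n}}, B' \proper B -> ~ tropical_basis R M B'.

(* Main.v *)
Require Import Defs.
From mathcomp Require Import all_boot all_order all_algebra.
From mathcomp Require Import reals.
From mathcomp Require Import classical_sets ereal.

(** The minimum of [x] over a nonempty [C] is attained twice exactly when no
    index of [C] is a strict minimizer, i.e. when every [j] in [C] has a rival
    [k != j] in [C] with [x_k <= x_j].  Everything is done with rivals.

    Basis.  Suppose that the minimum is attained twice on every circuit through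
    [i], and let [j] be an element of a circuit [C] avoiding [i].  Exchange [j]
    for [i]: in the new circuit [i] has a rival [k], which lies in [C :\ j].
    Now exchange this [k] for [i]: the rival of [j] there either lies in [C],
    or is [i], and then [x_k <= x_i <= x_j] makes [k] a rival of [j]
    ([attained_twice_of_through]).

    Minimality.  For a circuit [C] through [i], let [x] be [1] on [C :\ i] and
    [0] elsewhere.  On [C] the minimum is attained only at [i], while every
    other circuit through [i] leaves [C] somewhere, hence contains two zeros of
    [x] ([exists_separating_vec]).  So dropping [C] from the family enlarges the
    prevariety. *)

Set Implicit Arguments.
Unset Strict Implicit.
Unset Printing Implicit Defensive.

Import Order.TTheory GRing.Theory Num.Theory.
Local Open Scope ring_scope.

(** Two minimizers cannot both equal [j], so one of them is a rival of [j];
    conversely a minimizer and its rival are two minimizers. *)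
Lemma min_attained_twiceP (R : realType) (n : nat) (C : {set 'I_n})
    (x : tropical_vec R n) : C != finset.set0 ->
  reflect (forall j, j \in C -> exists k, [/\ k \in C, k != j &
             (tropical_coord x k <= tropical_coord x j)%E])
          (min_attained_twice C x).
Proof.
move=> C_neq0; apply: (iffP card_gt1P).
  move=> [a [b []]]; rewrite !inE.
  move=> /andP[aC /forall_inP amin] /andP[bC /forall_inP bmin] ab j jC.
  have [ja|ja] := eqVneq a j; last by exists a; split=> //; exact: amin.
  by exists b; split=> //; [rewrite -ja eq_sym | exact: bmin].
move=> rival; have [c cC] := finset.set0Pn _ C_neq0.
case: (arg_minP (tropical_coord x) cC) => j; rewrite -/(j \in C) => jC jmin.
have [k [kC kj xkj]] := rival j jC.
exists j, k; split; last by rewrite eq_sym.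
  by rewrite inE jC; apply/forall_inP.
rewrite inE kC; apply/forall_inP => l lC.
by apply: (le_trans xkj); exact: jmin.
Qed.

(** Two successive exchanges: the rival that [i] acquires when it replaces [j]
    is the element that [i] replaces next. *)
Lemma attained_twice_of_through (R : realType) (d n : nat) (i : 'I_n)
    (x : tropical_vec R n) :
  (forall C : {set 'I_n}, #|C| = d.+1 -> i \in C -> min_attained_twice C x) ->
  forall C : {set 'I_n}, #|C| = d.+1 -> min_attained_twice C x.
Proof.
move=> through C cardC.
have [iC|iC] := boolP (i \in C); first exact: through.
have card_exchange k : k \in C -> #|i |: C :\ k| = d.+1.
  move=> kC; rewrite cardsU1 !inE (negPf iC) andbF add1n.
  by move: cardC; rewrite (cardsD1 k) kC add1n.
have rival k j : k \in C -> j \in i |: C :\ k ->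
    exists l, [/\ l \in i |: C :\ k, l != j &
      (tropical_coord x l <= tropical_coord x j)%E].
  move=> kC; apply/min_attained_twiceP: j; last first.
    by apply: through; [exact: card_exchange | rewrite setU11].
  by apply/finset.set0Pn; exists i; rewrite setU11.
apply/min_attained_twiceP; first by rewrite -card_gt0 cardC.
move=> j jC.
have [|k []] := rival j i jC; first exact: setU11.
rewrite !inE => /orP[/eqP->|/andP[kj kC] _ xki]; first by rewrite eqxx.
have [|l []] := rival k j kC; first by rewrite !inE (eq_sym j k) kj jC orbT.
rewrite !inE => /orP[/eqP->|/andP[_ lC]] lj xlj; last by exists l.
by exists k; split=> //; exact: le_trans xlj.
Qed.

Lemma exists_tropical_vec (R : realType) (n : nat) (f : 'I_n -> R) (i : 'I_n) :
  exists x : tropical_vec R n, forall j, tropical_coord x j = (f j)%:E.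
Proof.
pose g : {ffun 'I_n -> tropical R} :=
  [ffun j => exist (fun y : \bar R => y != -oo%E) (f j)%:E isT].
have gP : [exists j, val (g j) != +oo%E] by apply/existsP; exists i; rewrite ffunE.
by exists (exist _ g gP) => j; rewrite /tropical_coord /= ffunE.
Qed.

(** The indicator of [C :\ i] separates [C] from its competitors.  Equality of
    cardinals prevents [D] from being a proper subset of [C], and so gives [D]
    an element outside [C]: the zero of [x] that accompanies [i]. *)
Lemma exists_separating_vec (R : realType) (n : nat) (i : 'I_n)
    (C : {set 'I_n}) : i \in C ->
  exists2 x : tropical_vec R n, ~~ min_attained_twice C x &
    forall D : {set 'I_n}, i \in D -> #|D| = #|C| -> D != C ->
      min_attained_twice D x.
Proof.
move=> iC.
have [x xE] := @exists_tropical_vec R n (fun j => (j \in C :\ i)%:R) i.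
exists x.
  apply/min_attained_twiceP; first by apply/finset.set0Pn; exists i.
  move=> /(_ i iC)[k [kC ki]].
  by rewrite !xE !inE kC ki eqxx /= lee_fin ler10.
move=> D iD cardD neDC.
have /fintype.subsetPn[j jD jC] : ~~ (D \subset C).
  by apply: contra neDC => sDC; rewrite eqEcard sDC cardD /=.
have zero_min l : l \notin C :\ i ->
    [forall k in D, (tropical_coord x l <= tropical_coord x k)%E].
  by move=> lC; apply/forall_inP => k _; rewrite !xE (negPf lC) lee_fin ler0n.
apply/card_gt1P; exists i, j; split.
- by rewrite inE iD zero_min // !inE eqxx.
- by rewrite inE jD zero_min // !inE (negPf jC) andbF.
- by apply: contraNneq jC => <-.
Qed.

Theorem lemma5 (R : realType) (d n : nat) (i : 'I_n)
    (hd1 : (1 <= d)%N) (hdn : (d <= n)%N) :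
  minimal_tropical_basis R (uniform_matroid d n)
    [set C in circuits (uniform_matroid d n) | i \in C].
Proof.
split.
  split; first by apply/fintype.subsetP => C; rewrite inE => /andP[].
  apply/seteqP; split=> p pB C /=.
    rewrite inE => /eqP cardC.
    apply: (@attained_twice_of_through _ _ _ i _ _ _ cardC) => D cardD iD.
    by apply: pB; rewrite /= !inE cardD eqxx iD.
  by rewrite inE => /andP[CU _]; exact: pB.
move=> B' /fintype.properP[/fintype.subsetP sB'B [C]]; rewrite !inE.
move=> /andP[/eqP cardC iC] CB' [_ eqB'].
have [x xC xD] := exists_separating_vec R iC.
have : tropical_prevariety R B' (\pi_(tropical_proj R n)%qT x).
  move=> D DB'; apply/tropical_hyp_pi.
  move: (sB'B D DB'); rewrite !inE => /andP[/eqP cardD iD].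
  by apply: xD; rewrite ?cardC //; apply: contraNneq CB' => <-.
rewrite eqB' => /(_ C).
rewrite /= inE cardC eqxx => /(_ isT)/tropical_hyp_pi.
exact/negP.
Qed.
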